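(* No algorithm for F-WGP that routes every packet along a shortest path from its origin to the sink can approximate F-WGP within a ratio better than $\Omega(m)$, where $m$ is the number of packets; that is, there is a constant $c>0$ such that for arbitrarily large $m$ there exist instances with $m$ packets on which every feasible schedule routing all packets along shortest paths has maximum flow time at least $c\cdot m$ times the optimal maximum flow time.
   Context: The Wireless Gathering Problem (WGP). An instance consists of a finite connected undirected graph $G=(V,E)$, a sink node $s\in V$, a positive integer $d_I$ (interference radius), and a set of packets $J=\{1,\dots,m\}$; each packet $j$ has an origin $o_j\in V$ and a release date $r_j\in\mathbb{Z}_{\ge 0}$. Time is divided into rounds $0,1,2,\dots$. In a round, if $u,v$ are adjacent, $u$ may send a packet it currently holds to $v$; this is a call $(u,v)$. Let $d(u,v)$ be the shortest-path distance in $G$. Two calls $(u,v)$ and $(u',v')$ in the same round interfere if $d(u',v)\le d_I$ or $d(u,v')\le d_I$; otherwise they are compatible. A feasible schedule specifies, for each round, a set of pairwise compatible calls, each moving one packet, such that every packet exists in a unique copy, packet $j$ is not sent before round $r_j$, and every packet eventually reaches $s$. If $x_j^t$ is the node holding $j$ at time $t$ (a packet sent in round $t$ is at its new node at time $t+1$), the completion time is $C_j=\min\{t: x_j^t=s\}$ and the flow time is $F_j=C_j-r_j$. F-WGP is the problem of finding a feasible schedule minimizing $\max_j F_j$. A packet is routed along a shortest path if the sequence of nodes it visits from $o_j$ to $s$ is a shortest $o_j$–$s$ path in $G$. *)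

(* Defs.v *)
From mathcomp Require Import all_boot.

Set Implicit Arguments.
Unset Strict Implicit.
Unset Printing Implicit Defensive.

Record graph := Graph {
  vertex :> finType;
  adj : rel vertex;
  adj_sym : symmetric adj;
  adj_irr : irreflexive adj;
  adj_connected : forall u v, connect adj u v
}.

Definition is_path (G : graph) (u v : G) (p : seq G) : bool :=
  path (@adj G) u p && (last u p == v).

Lemma ex_path_length (G : graph) (u v : G) :
  exists n, [exists p : n.-tuple G, is_path u v p].
Proof.
have /connectP[p up ->] := adj_connected u v.
by exists (size p); apply/existsP; exists (in_tuple p); rewrite /is_path up /=.
Qed.

Definition dist (G : graph) (u v : G) : nat := ex_minn (ex_path_length u v).

(* As in [path], the start vertex [u] is not listed in [p], so [size p] is the
   number of edges. *)
Definition is_shortest_path (G : graph) (u v : G) (p : seq G) : bool :=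
  is_path u v p && (size p == dist u v).

Record instance (m : nat) := Instance {
  network : graph;
  sink : network;
  radius : nat;
  radius_gt0 : 0 < radius;
  origin : 'I_m -> network;
  release : 'I_m -> nat
}.

Section Schedules.
Variables (m : nat) (I : instance m).
Implicit Types (j k : 'I_m) (t : nat).
Local Notation V := (network I).

Definition interfere (c c' : V * V) : bool :=
  (dist c'.1 c.2 <= radius I) || (dist c.1 c'.2 <= radius I).

Definition compatible (c c' : V * V) : bool := ~~ interfere c c'.

(* [send t j = Some v] means that in round [t] the node holding packet [j]
   sends it to [v]; [send t j = None] means that [j] is not sent in round [t].
   Each packet thus always exists in a unique copy. *)
Fixpoint position (send : nat -> 'I_m -> option V) t j : V :=
  if t is t'.+1 then odflt (position send t' j) (send t' j) else origin I j.

(* The nodes reached by packet [j] after leaving its origin, in the order of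
   the calls moving it in the rounds before [t]. *)
Fixpoint route (send : nat -> 'I_m -> option V) t j : seq V :=
  if t is t'.+1 then
    if send t' j is Some v then rcons (route send t' j) v
    else route send t' j
  else [::].

(* Every two packets moved in the same round need compatible calls. As
   [0 < radius], this also forbids moving two packets by the same call. *)
Record schedule := Schedule {
  send : nat -> 'I_m -> option V;
  send_adj : forall t j v, send t j = Some v -> adj (position send t j) v;
  send_released : forall t j v, send t j = Some v -> release I j <= t;
  send_compatible : forall t j k v w, j != k ->
    send t j = Some v -> send t k = Some w ->
    compatible (position send t j, v) (position send t k, w);
  send_delivers : forall j, exists t, position send t j == sink I
}.

Definition completion (S : schedule) j : nat := ex_minn (send_delivers S j).

(* A packet whose origin is not the sink completes after its release date; the
   subtraction is truncated only for packets originating at the sink, whose flow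
   time is thus 0. *)
Definition flow (S : schedule) j : nat := completion S j - release I j.

Definition max_flow (S : schedule) : nat := \max_(j < m) flow S j.

Definition optimal (S : schedule) : Prop :=
  forall S' : schedule, max_flow S <= max_flow S'.

Definition shortest_path_routing (S : schedule) : Prop :=
  forall j, is_shortest_path (origin I j) (sink I)
              (route (send S) (completion S j) j).

End Schedules.

(* Main.v *)
(* On the cycle of length 7 with interference radius 1, the origin 0 and the
   sink 4 are joined by a short side 0-6-5-4 and a long side 0-1-2-3-4; packet j
   is released in round 2j. Sending the packets alternately along the two sides
   without waiting is feasible, since only consecutive packets are ever moved in
   the same round, and has maximum flow time at most 4. The three calls of the
   short side pairwise interfere, so shortest path routing takes at least 3m
   rounds, while the last release is in round 2(m - 1): some packet has flow
   time at least m. *)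
Require Import Defs.
From mathcomp Require Import all_boot all_order all_algebra reals.
From mathcomp Require Import boolp zify.
Import Order.TTheory GRing.Theory Num.Theory.

Set Implicit Arguments.
Unset Strict Implicit.
Unset Printing Implicit Defensive.

(** * Distances in a graph *)

Lemma dist_le_size (G : graph) (u v : G) (p : seq G) :
  is_path u v p -> dist u v <= size p.
Proof.
rewrite /dist => uvp; case: ex_minnP => n _; apply.
by apply/existsP; exists (in_tuple p).
Qed.

(** For radius 1 this turns interference into equality and adjacency tests, which compute on
    concrete nodes. *)
Lemma dist_le1 (G : graph) (u v : G) : (dist u v <= 1) = (u == v) || adj u v.
Proof.
apply/idP/orP => [|[/eqP->|uv]].
- rewrite /dist; case: ex_minnP => n /existsP[p uvp] _ n_le1.
  have: size p <= 1 by rewrite size_tuple.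
  case: (tval p) uvp => [|x [|]] //= /andP[]; rewrite /= ?andbT; first by left.
  by move=> ux /eqP <- _; right.
- by apply: leq_trans (@dist_le_size _ _ _ [::] _) _ => //; rewrite /is_path /=.
- by apply: (@dist_le_size _ _ _ [:: v]); rewrite /is_path /= uv eqxx.
Qed.

(** * Routes, completion times and optimal schedules of an arbitrary instance *)

Section Schedules.
Variables (m : nat) (I : instance m).

Lemma last_route (send : nat -> 'I_m -> option (network I)) t j :
  last (origin I j) (route send t j) = position send t j.
Proof. by elim: t => //= t IHt; case: (send t j) => [v|]; rewrite ?last_rcons. Qed.

Lemma prefix_route (send : nat -> 'I_m -> option (network I)) t t' j :
  t <= t' -> prefix (route send t j) (route send t' j).
Proof.
elim: t' => [|t' IHt]; first by rewrite leqn0 => /eqP->.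
rewrite leq_eqVlt => /predU1P[->|]; first exact: prefix_refl.
rewrite ltnS => /IHt tt' /=; case: (send t' j) => [v|] //.
exact: prefix_trans tt' (prefix_rcons _ _).
Qed.

Lemma size_route (send : nat -> 'I_m -> option (network I)) t j :
  size (route send t j) = \sum_(i < t) send i j.
Proof.
elim: t => [|t IHt]; first by rewrite big_ord0.
rewrite big_ord_recr /= -IHt; case: (send t j) => [v|]; last by rewrite addn0.
by rewrite size_rcons addn1.
Qed.

Lemma release_lt_completion (S : schedule I) j :
  origin I j != sink I -> release I j < completion S j.
Proof.
move=> o_neq_s; rewrite ltnNge; apply/negP => C_le.
have stay t : t <= release I j -> position (send S) t j = origin I j.
  elim: t => //= t IHt lt_r; case E: (send S t j) => [v|] /=; last by rewrite IHt // ltnW.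
  by have := send_released E; rewrite leqNgt lt_r.
move: C_le; rewrite /completion; case: ex_minnP => n /eqP xn _ /stay xo.
by rewrite -xn xo eqxx in o_neq_s.
Qed.

Lemma completion_le (S : schedule I) t j :
  position (send S) t j = sink I -> completion S j <= t.
Proof. by rewrite /completion; case: ex_minnP => n _ min_n /eqP/min_n. Qed.

(** The maximum flow times form a nonempty set of natural numbers, so their minimum is attained. *)
Lemma optimal_exists (S : schedule I) : exists S' : schedule I, optimal S'.
Proof.
have ex_val : exists n, `[< exists S' : schedule I, max_flow S' = n >].
  by exists (max_flow S); apply/asboolP; exists S.
have [n /asboolP[S' S'n] min_n] := ex_minnP ex_val.
by exists S' => S''; rewrite S'n; apply: min_n; apply/asboolP; exists S''.
Qed.

(** Double counting of the pairs of a packet and a round before its completion in which it is sent: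
    by packets they add up to the route lengths, while each of the [T] rounds contributes at most
    one. Only rounds before completion count, since a schedule may move a packet on from the
    sink. *)
Lemma sequential_calls_bound (S : schedule I) T :
  (forall j, completion S j <= T) ->
  (forall t j k v w, t < completion S j -> t < completion S k ->
     send S t j = Some v -> send S t k = Some w -> j = k) ->
  \sum_(j < m) size (route (send S) (completion S j) j) <= T.
Proof.
move=> C_leT alone.
(* Moving the bound [completion S j] into the summand makes the range of rounds independent of [j],
   so that the sums can be exchanged. *)
have -> : \sum_(j < m) size (route (send S) (completion S j) j) =
    \sum_(j < m) \sum_(t < T) ((t < completion S j) && send S t j : nat).
  apply: eq_bigr => j _; rewrite size_route.
  rewrite (big_ord_widen _ (fun t => send S t j : nat) (C_leT j)) big_mkcond.
  by apply: eq_bigr => t _; case: ifP.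
rewrite exchange_big /= -[X in _ <= X]card_ord -sum1_card leq_sum // => t _.
case: (pickP (fun j => (t < completion S j) && send S t j)) => [j /andP[ltC]|none].
  case Ej: (send S t j) => [v|] // _.
  rewrite (bigD1 j) //= big1 ?addn0 ?leq_b1 // => k k_neq_j.
  case: ltnP => //= ltCk; case Ek: (send S t k) => [w|] //.
  by rewrite (alone _ _ _ _ _ ltCk ltC Ek Ej) eqxx in k_neq_j.
by rewrite big1 // => j _; rewrite none.
Qed.

End Schedules.

(** * The cycle of length 7 and its shortest path from 0 to 4 *)

Definition adj7 : rel 'I_7 := fun i j => (j == ordS i) || (i == ordS j).

Lemma adj7_sym : symmetric adj7.
Proof. by move=> i j; rewrite /adj7 orbC. Qed.

Lemma adj7_irr : irreflexive adj7.
Proof. by case=> [[|[|[|[|[|[|[|n]]]]]]] lt_n]. Qed.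

Lemma adj7_connected i j : connect adj7 i j.
Proof.
have from0 k : connect adj7 ord0 k.
  case: k; elim=> [|k IHk] lt_k7.
    by rewrite (_ : Ordinal lt_k7 = ord0) //; apply: val_inj.
  apply: connect_trans (IHk (ltnW lt_k7)) (connect1 _).
  by rewrite /adj7; apply/orP; left; apply/eqP/val_inj; rewrite /= modn_small.
apply: connect_trans (from0 j).
by rewrite (sym_connect_sym adj7_sym).
Qed.

Definition cycle7 : graph := Graph adj7_sym adj7_irr adj7_connected.

Local Notation node k := (@Ordinal 7 k isT).

Definition short_side : seq cycle7 := [:: node 6; node 5; node 4].
Definition long_side : seq cycle7 := [:: node 1; node 2; node 3; node 4].

Lemma shortest_path_short_side p :
  @is_shortest_path cycle7 (node 0) (node 4) p -> p = short_side.
Proof.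
case/andP => p_path /eqP size_p.
(* The short side bounds the distance by 3, so it suffices to test all paths with at most 3 edges;
   [dist] itself is never evaluated. *)
have: size p <= 3 by rewrite size_p; apply: (@dist_le_size cycle7 _ _ short_side).
pose nodes : seq cycle7 :=
  [:: node 0; node 1; node 2; node 3; node 4; node 5; node 6].
have all_nodes x : x \in nodes by case: x => [[|[|[|[|[|[|[|n]]]]]]] lt_x].
have path1 : all (fun x => ~~ @is_path cycle7 (node 0) (node 4) [:: x]) nodes.
  by vm_compute.
have path2 : all (fun x => all (fun y =>
    ~~ @is_path cycle7 (node 0) (node 4) [:: x; y]) nodes) nodes.
  by vm_compute.
have path3 : all (fun x => all (fun y => all (fun z =>
    @is_path cycle7 (node 0) (node 4) [:: x; y; z] ==>
    ([:: x; y; z] == short_side)) nodes) nodes) nodes.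
  by vm_compute.
case: p p_path {size_p} => [|x [|y [|z [|]]]] // p_path _.
- by have /negP := allP path1 x (all_nodes x).
- by have /allP/(_ y (all_nodes y))/negP := allP path2 x (all_nodes x).
- have /allP/(_ y (all_nodes y))/allP/(_ z (all_nodes z)) :=
    allP path3 x (all_nodes x).
  by move/implyP/(_ p_path)/eqP.
Qed.

(** * The instance and its alternating schedule *)

Section Gathering.
Variable m : nat.

Definition gathering : instance m :=
  @Instance m cycle7 (node 4) 1 isT (fun=> node 0) (fun j => j.*2).

Implicit Types (j k : 'I_m) (t : nat).

Definition side j := if odd j then long_side else short_side.

Definition alternating_send t j : option (network gathering) :=
  if j.*2 <= t then onth (side j) (t - j.*2) else None.

(** Truncated subtraction keeps the packet at node 0 until its release, and the default value of
    [nth] keeps it at the sink after arrival. *)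
Lemma alternating_position t j :
  @position m gathering alternating_send t j =
  nth (node 4) (node 0 :: side j) (t - j.*2).
Proof.
elim: t => [|t IHt] //=; rewrite IHt /alternating_send.
case: leqP => [le_jt|lt_tj]; last first.
  by rewrite (eqP (ltnW lt_tj : _ - _ == 0)) (eqP (lt_tj : _ - _ == 0)).
rewrite subSn // /side; move: (t - _) => a.
by case: (odd j); case: a => [|[|[|[|[|a]]]]] //=; rewrite nth_nil.
Qed.

Lemma alternating_sendP t j v : alternating_send t j = Some v ->
  [/\ j.*2 <= t, t - j.*2 < 4 & onth (side j) (t - j.*2) = Some v].
Proof.
rewrite /alternating_send; case: (leqP j.*2 t) => // le_jt jv; split=> //.
have /esym lt_side := onthTE (side j) (t - j.*2); rewrite jv /= in lt_side.
by apply: leq_trans lt_side _; rewrite /side; case: (odd j).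
Qed.

Lemma alternating_adj t j v : alternating_send t j = Some v ->
  adj (@position m gathering alternating_send t j) v.
Proof.
case/alternating_sendP => _; rewrite alternating_position /side.
move: (t - _) => a.
by case: (odd j); case: a => [|[|[|[|a]]]] // _ [<-].
Qed.

Lemma alternating_released t j v :
  alternating_send t j = Some v -> release gathering j <= t.
Proof. by case/alternating_sendP. Qed.

Lemma compatibleE (c c' : network gathering * network gathering) :
  @compatible m gathering c c' =
  ~~ ((c'.1 == c.2) || adj c'.1 c.2 || ((c.1 == c'.2) || adj c.1 c'.2)).
Proof. by rewrite /compatible /interfere !dist_le1. Qed.

Lemma compatibleC (c c' : network gathering * network gathering) :
  @compatible m gathering c c' = @compatible m gathering c' c.
Proof. by rewrite /compatible /interfere orbC. Qed.

Lemma alternating_compatible t j k v w : j != k ->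
  alternating_send t j = Some v -> alternating_send t k = Some w ->
  @compatible m gathering (@position m gathering alternating_send t j, v)
                          (@position m gathering alternating_send t k, w).
Proof.
wlog lt_jk : j k v w / j < k => [IH|_].
  rewrite neq_ltn => /orP[] lt jv kw; first by apply: IH => //; rewrite neq_ltn lt.
  by rewrite compatibleC; apply: IH => //; rewrite neq_ltn lt.
move=> /alternating_sendP[le_j a4 jv] /alternating_sendP[le_k b4 kw].
rewrite !alternating_position compatibleE.
(* The two offsets differ by a positive even number and lie below 4, so they differ by exactly 2.
   Hence [k] is the successor of [j] and uses the other side. *)
have ab : t - j.*2 = (t - k.*2).+2 by lia.
have odd_k : odd k = ~~ odd j.
  by have -> : val k = j.+1 by move: ab lt_jk => /=; lia.
rewrite ab in a4 jv *; move: jv kw a4; rewrite /side odd_k; move: (t - _) => b.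
by case: (odd j); case: b => [|[|b]] //= [<-] // [<-].
Qed.

Lemma alternating_arrives j :
  @position m gathering alternating_send (j.*2 + 4) j = node 4.
Proof. by rewrite alternating_position addKn /side; case: (odd j). Qed.

Lemma alternating_delivers j :
  exists t, @position m gathering alternating_send t j == sink gathering.
Proof. by exists (j.*2 + 4); rewrite alternating_arrives. Qed.

Definition alternating_schedule : schedule gathering :=
  Schedule alternating_adj alternating_released alternating_compatible
           alternating_delivers.

Lemma alternating_max_flow : max_flow alternating_schedule <= 4.
Proof.
apply/bigmax_leqP => j _; rewrite /flow leq_subLR.
exact/completion_le/alternating_arrives.
Qed.

Lemma max_flow_gt0 (S : schedule gathering) : 0 < m -> 0 < max_flow S.
Proof.
move=> m_gt0; apply: leq_trans (leq_bigmax (Ordinal m_gt0)).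
by rewrite subn_gt0 release_lt_completion.
Qed.

(** * Lower bound for shortest path routing *)

Definition short_side_calls : seq (cycle7 * cycle7) :=
  [:: (node 0, node 6); (node 6, node 5); (node 5, node 4)].

(** As [t < completion S j], the route after round [t] is a prefix of the short side; it ends with
    [v], preceded by the current position. *)
Lemma shortest_path_calls (S : schedule gathering) t j v :
  shortest_path_routing S -> t < completion S j -> send S t j = Some v ->
  (position (send S) t j, v) \in short_side_calls.
Proof.
move=> /(_ j)/shortest_path_short_side S_short ltC jv.
have := @prefix_route _ _ (send S) _ _ j ltC; rewrite S_short -last_route /= jv.
case: (route _ t j) => [|x [|y [|z r]]] /=.
- by rewrite andbT => /eqP->.
- by case/and3P => /eqP-> /eqP->.
- by case/and4P => _ /eqP-> /eqP->.
- by case: r => [|? ?]; rewrite !andbF.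
Qed.

Lemma shortest_path_max_flow (S : schedule gathering) :
  shortest_path_routing S -> m <= max_flow S.
Proof.
move=> S_short; have [m0|m_gt0] := posnP m; first exact: leq_trans (eq_leq m0) (leq0n _).
have C_le j : completion S j <= max_flow S + m.-1.*2.
  have := leq_bigmax (F := flow S) j; rewrite -/(max_flow S) /flow /=.
  by have := ltn_ord j; lia.
have := sequential_calls_bound C_le; rewrite (eq_bigr (fun=> 3)); last first.
  by move=> j _; rewrite (shortest_path_short_side (S_short j)).
rewrite sum_nat_const card_ord => calls_le; suff: m * 3 <= max_flow S + m.-1.*2 by lia.
apply: calls_le => t j k v w ltj ltk jv kw; apply/eqP/negPn/negP => j_neq_k.
have := send_compatible j_neq_k jv kw; rewrite compatibleE.
have := shortest_path_calls S_short ltj jv.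
have := shortest_path_calls S_short ltk kw.
(* In all nine pairs of short side calls, equal ones included, some sender is within distance 1 of
   the other call's receiver. *)
by rewrite !inE => /or3P[] /eqP-> /or3P[] /eqP->.
Qed.

End Gathering.

Local Open Scope ring_scope.

Theorem theorem3p3 (R : realType) :
  exists c : R, 0 < c /\
    forall M : nat, exists m : nat, (M <= m)%N /\
      exists (I : instance m) (Sopt : schedule I),
        optimal Sopt /\ (0 < max_flow Sopt)%N /\
        forall S : schedule I, shortest_path_routing S ->
          c * m%:R * (max_flow Sopt)%:R <= (max_flow S)%:R.
Proof.
(* The 4 is the flow time bound of the alternating schedule; [M.+1] packets make the optimum
   positive even for [M = 0]. *)
exists 4%:R^-1; split=> [|M]; first by rewrite invr_gt0 ltr0n.
exists M.+1; split=> //; exists (gathering M.+1).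
have [Sopt Sopt_opt] := optimal_exists (alternating_schedule M.+1).
exists Sopt; split=> //; split=> [|S S_short]; first exact: max_flow_gt0.
rewrite -mulrA ler_pdivrMl ?ltr0n // -!natrM ler_nat mulnC leq_mul //.
  exact: leq_trans (Sopt_opt _) (alternating_max_flow _).
exact: shortest_path_max_flow.
Qed.
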